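(* Let $A$ be any $2n\times 2n$ real positive definite matrix. Then $\Delta_c(A)\prec^w d_s(A)$. Conversely, if $x=(x_1,\ldots,x_n)$ and $y=(y_1,\ldots,y_n)$ are vectors with all entries positive such that $x\prec^w y$, then there exists a $2n\times 2n$ real positive definite matrix $A$ such that $\Delta_c(A)=x$ and the symplectic eigenvalues of $A$, counted with multiplicity, are $y_1,\ldots,y_n$ (i.e. $d_s(A)$ is the increasing rearrangement of $y$).
   Context: Let $J=\begin{bmatrix}0 & I_n\\ -I_n & 0\end{bmatrix}$ and $Sp(2n)=\{M\in\mathbb{R}^{2n\times 2n}: M^TJM=J\}$. By Williamson's theorem, for every $2n\times 2n$ real positive definite matrix $A$ there is $M\in Sp(2n)$ with $M^TAM=\begin{bmatrix}D&0\\0&D\end{bmatrix}$, $D$ a positive diagonal $n\times n$ matrix; its diagonal entries, uniquely determined by $A$ and listed as $d_1(A)\le\cdots\le d_n(A)$, are the symplectic eigenvalues of $A$. Write $d_s(A)=(d_1(A),\ldots,d_n(A))$. For $A=(a_{ij})$ a $2n\times 2n$ real positive definite matrix, define $\Delta_c(A)\in\mathbb{R}^n$ by $\Delta_c(A)_j=\tfrac12\left(a_{jj}+a_{n+j,n+j}\right)$, $1\le j\le n$ (the entrywise arithmetic mean of the diagonals of the two diagonal $n\times n$ blocks of $A$). For $x\in\mathbb{R}^n$ let $x_1^{\uparrow}\le\cdots\le x_n^{\uparrow}$ denote its entries in increasing order. For $x,y\in\mathbb{R}^n$, $x\prec^w y$ (weak supermajorisation) means $\sum_{j=1}^k x_j^{\uparrow}\ge\sum_{j=1}^k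 y_j^{\uparrow}$ for all $1\le k\le n$. *)

(* Defs.v *)
From HB Require Import structures.
From mathcomp Require Import all_boot all_order all_algebra.
From mathcomp Require Import reals.
Set Implicit Arguments.
Unset Strict Implicit.
Unset Printing Implicit Defensive.
Import Order.TTheory GRing.Theory Num.Theory.
Local Open Scope ring_scope.

Section Defs.
Variable R : realType.

Definition Jmx (n : nat) : 'M[R]_(n + n) :=
  block_mx 0 1%:M (- 1%:M) 0.

Definition symplectic (n : nat) (M : 'M[R]_(n + n)) : Prop :=
  M^T *m Jmx n *m M = Jmx n.

Definition posdef (m : nat) (A : 'M[R]_m) : Prop :=
  A^T = A /\ forall v : 'rV[R]_m, v != 0 -> 0 < (v *m A *m v^T) 0 0.

(* d is the vector of symplectic eigenvalues d_1 <= ... <= d_n of A: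
   positive, increasingly ordered, and M^T A M = diag(D, D) for some
   symplectic M (Williamson normal form). *)
Definition symp_eigs (n : nat) (A : 'M[R]_(n + n)) (d : 'rV[R]_n) : Prop :=
  (forall i, 0 < d 0 i) /\
  (forall i j : 'I_n, (i <= j)%N -> d 0 i <= d 0 j) /\
  exists M : 'M[R]_(n + n), symplectic M /\
    M^T *m A *m M = block_mx (diag_mx d) 0 0 (diag_mx d).

Definition Delta_c (n : nat) (A : 'M[R]_(n + n)) : 'rV[R]_n :=
  \row_j ((A (lshift n j) (lshift n j) + A (rshift n j) (rshift n j)) / 2).

Definition incr_seq (n : nat) (x : 'rV[R]_n) : seq R :=
  sort <=%R [seq x 0 i | i <- enum 'I_n].

Definition incr_vec (n : nat) (x : 'rV[R]_n) : 'rV[R]_n :=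
  \row_i nth 0 (incr_seq x) i.

Definition wsupmaj (n : nat) (x y : 'rV[R]_n) : Prop :=
  forall k : nat, (1 <= k <= n)%N ->
    \sum_(j < k) nth 0 (incr_seq y) j <= \sum_(j < k) nth 0 (incr_seq x) j.

End Defs.

(* Main.v *)
(* Write [A = N^T *m (D (+) D) *m N] with [N] symplectic.  Then
   [Delta_c A = d *m S], where [S] averages the squares of the four blocks of
   [N].  Every [I x K] block of [S] has sum at least [#|I| + #|K| - n]: the
   rows of [N] outside [I] have rank at most [2 (n - #|I|)], so on a subspace
   of dimension [2 (#|I| + #|K| - n)] of the columns in [K] the remaining rows
   reproduce the symplectic form, and Cauchy-Schwarz bounds their Frobenius
   norm from below.  Abel summation turns this into the supermajorization.

   Conversely, Horn's induction, run with inequalities, gives an orthogonal [V]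
   such that the diagonal [u] of [V^T *m diag(y) *m V] lies below [x].  The
   symplectic squeeze by [diag(t)] and [diag(t)^-1] on the two copies of this
   matrix replaces [u_i] by [u_i (t_i^2 + t_i^-2) / 2], which takes the value
   [x_i] for a suitable [t_i]. *)
Require Import Defs.
From HB Require Import structures.
From mathcomp Require Import all_boot all_order all_algebra.
From mathcomp Require Import perm reals ring lra.
Set Implicit Arguments.
Unset Strict Implicit.
Unset Printing Implicit Defensive.
Import Order.TTheory GRing.Theory Num.Theory.
Local Open Scope ring_scope.

(** * Frobenius norms, orthogonal projections and a rank bound *)

Section Frobenius.
Variable R : realType.

Definition frob (m p : nat) (X : 'M[R]_(m, p)) : R := \tr (X^T *m X).

Lemma frobE (m p : nat) (X : 'M[R]_(m, p)) :
  frob X = \sum_i \sum_j X i j ^+ 2.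
Proof.
rewrite /frob /mxtrace exchange_big /=; apply: eq_bigr => j _.
by rewrite mxE; apply: eq_bigr => i _; rewrite mxE expr2.
Qed.

Lemma frob_ge0 (m p : nat) (X : 'M[R]_(m, p)) : 0 <= frob X.
Proof.
by rewrite frobE; do 2!apply: sumr_ge0 => ? _; rewrite sqr_ge0.
Qed.

Lemma frob_inner_le (m p : nat) (X Z : 'M[R]_(m, p)) :
  \tr (X^T *m Z) <= (frob X + frob Z) / 2.
Proof.
have := frob_ge0 (X - Z).
rewrite /frob [(X - Z)^T]linearB /= mulmxBl !mulmxBr !linearB /=.
have -> : \tr (Z^T *m X) = \tr (X^T *m Z).
  by rewrite -mxtrace_tr trmx_mul trmxK.
lra.
Qed.

Lemma frob_isoml (m p : nat) (U : 'M[R]_m) (X : 'M[R]_(m, p)) :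
  U^T *m U = 1%:M -> frob (U *m X) = frob X.
Proof. by move=> UU; rewrite /frob trmx_mul mulmxA -(mulmxA X^T) UU mulmx1. Qed.

Lemma frob_isomr (m p : nat) (U : 'M[R]_p) (X : 'M[R]_(m, p)) :
  U^T *m U = 1%:M -> frob (X *m U) = frob X.
Proof.
move=> /mulmx1C UU.
by rewrite /frob trmx_mul -mulmxA mxtrace_mulC -!mulmxA UU mulmx1.
Qed.

Definition orthoproj (m : nat) (P : 'M[R]_m) : Prop := P^T = P /\ P *m P = P.

(** Pythagoras: [1 - P] is again an orthogonal projection, and the two squared norms add up to
    [frob X]. *)
Lemma frob_projr (m p : nat) (P : 'M[R]_p) (X : 'M[R]_(m, p)) :
  orthoproj P -> frob (X *m P) <= frob X.
Proof.
move=> [Pt PP].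
have frobQ (Q : 'M_p) : Q^T = Q -> Q *m Q = Q -> frob (X *m Q) = \tr (X^T *m X *m Q).
  by move=> Qt QQ; rewrite /frob trmx_mul Qt mulmxA mxtrace_mulC !mulmxA QQ -mulmxA mxtrace_mulC.
have := frob_ge0 (X *m (1%:M - P)).
rewrite frobQ; last first.
- by rewrite mulmxBl !mulmxBr !mulmx1 mul1mx PP subrr subr0.
- by rewrite [LHS]linearB /= trmx1 Pt.
rewrite mulmxBr mulmx1 linearB /= -frobQ //; rewrite /frob; lra.
Qed.

Lemma orthoproj_diag (m : nat) (t : 'rV[R]_m) :
  (forall i, t 0 i = 0 \/ t 0 i = 1) -> orthoproj (diag_mx t).
Proof.
move=> t01; split; first exact: tr_diag_mx.
rewrite mulmx_diag; congr diag_mx; apply/rowP => i; rewrite mxE.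
by case: (t01 i) => ->; rewrite ?mulr0 ?mulr1.
Qed.

Lemma row_diag_mul (m p : nat) (t : 'rV[R]_m) (X : 'M[R]_(m, p)) i :
  row i (diag_mx t *m X) = t 0 i *: row i X.
Proof. by apply/rowP => j; rewrite mul_diag_mx !mxE. Qed.

(** Gram-Schmidt with the trace in the role of the rank. A vector [z] not yet killed has a nonzero
    image [w] under [P]; removing the rank-one projection onto [w] kills [z], keeps the earlier
    vectors killed and lowers the trace by exactly one. *)
Lemma orthoproj_kill (m : nat) (Q : 'M[R]_m) (s : seq 'rV[R]_m) :
  orthoproj Q -> exists P : 'M[R]_m,
    [/\ orthoproj P, Q *m P = P, forall z, z \in s -> z *m P = 0
      & \tr Q - (size s)%:R <= \tr P].
Proof.
move=> [Qt QQ]; elim: s => [|z s [P [[Pt PP] QP Ps trP]]].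
  by exists Q; split => //; rewrite subr0.
have [zP0|zP_neq0] := eqVneq (z *m P) 0.
  exists P; split => // [w|].
    by rewrite inE => /predU1P[->|/Ps].
  by rewrite (le_trans _ trP) //= lerD2l lerN2 ler_nat.
pose w := z *m P; pose c := (w *m w^T) 0 0.
have wwE : w *m w^T = c%:M by rewrite [LHS]mx11_scalar.
have c_neq0 : c != 0.
  apply: contraNneq zP_neq0 => c0; apply/eqP/matrixP => i j.
  have := c0; rewrite /c mxE => /psumr_eq0P wj.
  rewrite ord1 [RHS]mxE; apply/eqP; rewrite -sqrf_eq0 expr2.
  have := wj _ j isT; rewrite [w^T j 0]mxE => -> // k _.
  by rewrite [w^T _ _]mxE -expr2 sqr_ge0.
have wP : w *m P = w by rewrite /w -mulmxA PP.
have Pw : P *m w^T = w^T by rewrite -{1}Pt -trmx_mul wP.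
have zw : z *m w^T = c%:M by rewrite -wwE /w -{1}Pw mulmxA.
exists (P - c^-1 *: (w^T *m w)); split.
- split; first by rewrite linearB linearZ /= trmx_mul trmxK Pt.
  rewrite mulmxBl !mulmxBr -!scalemxAl -!scalemxAr PP -(mulmxA w^T w P) wP.
  rewrite (mulmxA P) Pw -(mulmxA w^T w) (mulmxA w w^T) wwE mul_scalar_mx.
  by rewrite -scalemxAr [c^-1 *: (c *: _)]scalerA mulVf // scale1r subrr subr0.
- rewrite mulmxBr -scalemxAr QP mulmxA; congr (_ - _ *: (_ *m _)).
  by rewrite -Pw mulmxA QP.
- move=> u; rewrite inE => /predU1P[->|us]; rewrite mulmxBr -scalemxAr mulmxA.
    by rewrite zw mul_scalar_mx scalerA mulVf // scale1r subrr.
  have uw : u *m w^T = 0 by rewrite -Pw mulmxA Ps // mul0mx.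
  by rewrite Ps // uw mul0mx scaler0 subrr.
rewrite linearB linearZ /= mxtrace_mulC wwE mxtrace_scalar mulr1n mulVf //.
rewrite -addn1 natrD; lra.
Qed.

(* [P] projects into the range of [Q] and is killed by the rows of [N] outside
   [T], so that [J *m P = N^T *m J *m N *m P] sees only the block
   [T *m N *m Q]; pairing it with [J *m P] turns [\tr P] into an inner product
   of two contractions of that block. *)
Lemma frob_block_ge (m : nat) (J N Q : 'M[R]_m) (s : seq 'I_m)
    (T := diag_mx (\row_i (i \notin s)%:R) : 'M[R]_m) :
    J^T *m J = 1%:M -> N^T *m J *m N = J -> J *m T = T *m J ->
    orthoproj Q -> J *m Q = Q *m J ->
  \tr Q - (size s)%:R <= frob (T *m N *m Q).
Proof.
move=> JJ NJN JT projQ JQ; have [Qt QQ] := projQ.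
have [P [[Pt PP] QP Ps]] := orthoproj_kill [seq row i N | i <- s] projQ.
rewrite size_map => /le_trans; apply.
have [Tt TT] : orthoproj T.
  by apply: orthoproj_diag => i; rewrite mxE; case: (_ \notin _); [right|left].
have TNP : T *m N *m P = N *m P.
  apply/row_matrixP => i; rewrite -mulmxA row_diag_mul mxE.
  case: (boolP (i \in s)) => [si|_]; last by rewrite scale1r.
  by rewrite scale0r row_mul Ps //; apply/mapP; exists i.
set Y := T *m N *m Q.
have YP : Y *m P = N *m P by rewrite /Y -mulmxA QP TNP.
have PQ : P *m Q = P by rewrite -[LHS]trmxK trmx_mul Pt Qt QP Pt.
have YJP : Y^T *m (J *m Y *m P) = J *m P.
  have TJNP : T *m (J *m (N *m P)) = J *m (N *m P).
    by rewrite mulmxA -JT -mulmxA (mulmxA T N) TNP.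
  rewrite -(mulmxA J) YP !trmx_mul Tt Qt -!mulmxA TJNP.
  rewrite (mulmxA J) (mulmxA N^T) (mulmxA N^T) NJN.
  by rewrite mulmxA -JQ -mulmxA QP.
clearbody Y.
have -> : \tr P = \tr ((Y *m J *m P)^T *m (J *m Y *m P)).
  rewrite !trmx_mul -!mulmxA (mulmxA J) YJP.
  by rewrite (mulmxA J^T) JJ mul1mx Pt PP.
apply: le_trans (frob_inner_le _ _) _.
have projP : orthoproj P by [].
have := frob_projr (Y *m J) projP; rewrite (frob_isomr Y JJ).
have := frob_projr (J *m Y) projP; rewrite (frob_isoml Y JJ).
lra.
Qed.
End Frobenius.

(** * Weak supermajorization from lower bounds on block sums *)

Section Majorization.
Variable R : realType.

(* Abel summation, in the form that survives induction on [n]. *)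
Lemma sum_mul_tail_ge (n : nat) (d e : nat -> R) :
    (forall i j, (i <= j < n)%N -> d i <= d j) ->
    (forall m, 0 <= \sum_(m <= i < n) e i) ->
  d 0%N * \sum_(0 <= i < n) e i <= \sum_(0 <= i < n) d i * e i.
Proof.
elim: n d e => [|n IHn] d e d_mono e_tail; first by rewrite !big_geq ?mulr0.
rewrite !big_nat_recl // mulrDr lerD2l.
have tailE m : \sum_(m <= i < n) e i.+1 = \sum_(m.+1 <= i < n.+1) e i.
  by rewrite big_add1.
(* The induction hypothesis has [d 1] as its factor; as the remaining sum of [e] is nonnegative, the
   factor may be lowered to [d 0]. *)
apply: le_trans (IHn (fun i => d i.+1) (fun i => e i.+1) _ _).
  rewrite -subr_ge0 -mulrBl.
  have := e_tail 1%N; rewrite -tailE.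
  case: n d_mono {IHn e_tail tailE} => [|n] d_mono; first by rewrite big_geq ?mulr0.
  by move=> e_ge0; rewrite mulr_ge0 // subr_ge0 d_mono.
  by move=> i j ij; apply: d_mono.
by move=> m; rewrite tailE.
Qed.

Lemma perm_nth (n : nat) (s t : seq R) :
    perm_eq s t -> size t = n ->
  exists p : 'S_n, forall i : 'I_n, nth 0 s i = nth 0 t (p i).
Proof.
move=> st tn; have tn' : size t == n by apply/eqP.
have /tuple_permP[p sE] : perm_eq s (Tuple tn') by [].
by exists p => i; rewrite sE -tnth_nth tnth_mktuple (tnth_nth 0).
Qed.

Lemma size_incr_seq (n : nat) (x : 'rV[R]_n) : size (incr_seq x) = n.
Proof. by rewrite size_sort size_map size_enum_ord. Qed.

Lemma incr_seq_sorted (n : nat) (x : 'rV[R]_n) : sorted <=%R (incr_seq x).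
Proof. by apply: sort_sorted; apply: le_total. Qed.

Lemma nth_incr_seq (n : nat) (x : 'rV[R]_n) :
  exists p : 'S_n, forall i : 'I_n, nth 0 (incr_seq x) i = x 0 (p i).
Proof.
have px : perm_eq (incr_seq x) [seq x 0 i | i <- enum 'I_n] by rewrite perm_sort.
have [|p pE] := perm_nth (n := n) px; first by rewrite size_map size_enum_ord.
exists p => i; rewrite pE (nth_map i) ?size_enum_ord //.
by rewrite nth_ord_enum.
Qed.

Lemma incr_seq_mono (n : nat) (x : 'rV[R]_n) (i j : nat) :
  (i <= j < n)%N -> nth 0 (incr_seq x) i <= nth 0 (incr_seq x) j.
Proof.
case/andP=> ij jn.
apply: (sorted_leq_nth le_trans lexx 0 (incr_seq_sorted x)) => //.
  by rewrite inE size_incr_seq (leq_ltn_trans ij).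
by rewrite inE size_incr_seq.
Qed.

Lemma nth_incr_seq_sorted (n : nat) (x : 'rV[R]_n) (i : 'I_n) :
    (forall i j : 'I_n, (i <= j)%N -> x 0 i <= x 0 j) ->
  nth 0 (incr_seq x) i = x 0 i.
Proof.
move=> x_mono; rewrite /incr_seq sorted_sort; first 1 last.
- exact: le_trans.
- rewrite sorted_map; apply: (@sub_sorted _ (relpre val leq)) => //.
  by rewrite -sorted_map val_enum_ord iota_sorted.
by rewrite (nth_map i) ?size_enum_ord // nth_ord_enum.
Qed.

(** The [k] smallest entries of [x] sum to a combination of the [d i] with weights [t i], the row
    sums of [S] over the columns in [K]. The block bounds make the tails of [t] dominate those of
    the indicator of the first [k] indices, and Abel summation concludes. *)
Lemma wsupmaj_superstochastic (n : nat) (x d : 'rV[R]_n) (S : 'M[R]_n) :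
    (forall i, 0 < d 0 i) -> (forall i j : 'I_n, (i <= j)%N -> d 0 i <= d 0 j) ->
    (forall i j, 0 <= S i j) ->
    (forall I K : {set 'I_n},
      (#|I| + #|K|)%:R - n%:R <= \sum_(i in I) \sum_(j in K) S i j) ->
    (forall j, x 0 j = \sum_i d 0 i * S i j) ->
  wsupmaj x d.
Proof.
move=> d_gt0 d_mono S_ge0 S_super xE k /andP[k_gt0 kn].
have [p pE] := nth_incr_seq x.
pose K := [set p i | i : 'I_n & (i < k)%N].
have cardK : #|K|%:R = k%:R :> R.
  rewrite -sumr_const big_imset /=; last by move=> i j _ _; apply: perm_inj.
  rewrite (eq_bigl (fun i : 'I_n => (i < k)%N)) => [|i]; last by rewrite inE.
  by rewrite -(big_ord_widen n (fun=> 1)) // sumr_const card_ord.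
pose t i := \sum_(j in K) S i j.
have sumx : \sum_(j < k) nth 0 (incr_seq x) j = \sum_i d 0 i * t i.
  rewrite (big_ord_widen _ (fun i => nth 0 (incr_seq x) i) kn).
  under eq_bigr do rewrite pE.
  transitivity (\sum_(j in K) x 0 j).
    rewrite [RHS]big_imset /=; last by move=> i j _ _; apply: perm_inj.
    by apply: eq_bigl => i; rewrite inE.
  under eq_bigr do rewrite xE.
  by rewrite exchange_big /=; apply: eq_bigr => i _; rewrite mulr_sumr.
pose D i := nth 0 (incr_seq d) i.
(* Abel summation is stated over [nat], so [t] is extended by 0 beyond [n]. *)
pose e i := oapp t 0 (insub i) - (i < k)%:R.
have t_ge0 i : 0 <= t i by apply: sumr_ge0 => j _.
have eE (i : 'I_n) : e i = t i - (i < k)%:R by rewrite /e valK.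
have sum_ltk m (F : nat -> R) :
    \sum_(m <= i < n) F i * (i < k)%:R = \sum_(m <= i < k) F i.
  rewrite (big_nat_widen m k n) // [RHS]big_mkcond; apply: eq_bigr => i _.
  by rewrite mulr_natr mulrb.
have e_tail m : 0 <= \sum_(m <= i < n) e i.
  rewrite sumrB big_geq_mkord /=.
  have -> : \sum_(m <= i < n) (i < k)%:R = (k - m)%:R :> R.
    under eq_bigr do rewrite -[_%:R]mul1r.
    by rewrite sum_ltk sumr_const_nat.
  under eq_bigr do rewrite valK /=.
  (* Beyond [k] only the nonnegative [t i] remain. Before [k], the block of rows from [m] on has sum
     at least [(n - m) + k - n = k - m]. *)
  have [km|mk] := leqP k m.
    by rewrite (eqP km) subr0 sumr_ge0.
  pose I := [set i : 'I_n | (m <= i)%N].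
  have cardI : #|I|%:R = (n - m)%:R :> R.
    rewrite -sumr_const -[RHS]sumr_const_nat big_geq_mkord.
    by apply: eq_bigl => i; rewrite inE.
  have := S_super I K; rewrite natrD cardI cardK.
  rewrite !natrB ?(ltnW mk) ?(leq_trans (ltnW mk)) //.
  have -> : \sum_(i in I) \sum_(j in K) S i j = \sum_(i < n | (m <= i)%N) t i.
    by apply: eq_bigl => i; rewrite inE.
  lra.
have n_gt0 : (0 < n)%N by apply: leq_trans kn.
have D0 : 0 <= D 0%N by rewrite /D (nth_incr_seq_sorted (Ordinal n_gt0)) // ltW.
have := le_trans (mulr_ge0 D0 (e_tail 0%N)) (@sum_mul_tail_ge n D e _ e_tail).
move=> /(_ (@incr_seq_mono _ d)).
under eq_bigr do rewrite /e mulrBr.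
rewrite sumrB subr_ge0 sumx.
rewrite sum_ltk !big_mkord; congr (_ <= _); apply: eq_bigr => i _.
by rewrite /D nth_incr_seq_sorted // valK.
Qed.
End Majorization.

(** * Horn's construction of a conjugate with bounded diagonal *)

Section Horn.
Variable R : realType.

(* [y] are eigenvalues, and [x] bounds the diagonal of a conjugate of
   [diag(y)]. *)
Definition diag_le_orbit (n : nat) (x y : seq R) : Prop :=
  exists O : 'M[R]_n, O^T *m O = 1%:M /\
    forall i : 'I_n, \sum_(j < n) nth 0 y j * O j i ^+ 2 <= nth 0 x i.

Lemma diag_le_orbit_perm (n : nat) (x y y' : seq R) :
  perm_eq y y' -> size y' = n -> diag_le_orbit n x y -> diag_le_orbit n x y'.
Proof.
rewrite perm_sym => yy' sz [O [OO Ox]].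
have szy : size y = n by rewrite -(perm_size yy').
have [p pE] := perm_nth yy' szy.
exists (row_perm p O); split=> [|i].
  rewrite row_permE trmx_mul -mulmxA (mulmxA _^T (perm_mx p)) tr_perm_mx.
  by rewrite -perm_mxM mulVg perm_mx1 mul1mx.
apply: le_trans (Ox i); rewrite [leRHS](reindex_inj (@perm_inj _ p)) /=.
by apply: ler_sum => j _; rewrite mxE pE.
Qed.

Lemma rotation_exists (a b t : R) : a <= t -> t < b ->
  exists c s : R, c ^+ 2 + s ^+ 2 = 1 /\ a * c ^+ 2 + b * s ^+ 2 = t.
Proof.
move=> at_ tb; have ab : 0 < b - a by lra.
exists (Num.sqrt ((b - t) / (b - a))), (Num.sqrt ((t - a) / (b - a))).
rewrite !sqr_sqrtr ?divr_ge0 //; try lra.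
by split; field; lra.
Qed.

(** A rotation of the first two coordinates turns the diagonal [a, b] into [t, a + b - t]. The
    matrix [O] then acts on all coordinates but the first, so the entry [t] survives and the
    off-diagonal entries created beside it do no harm. *)
Lemma diag_le_orbit_cons (n : nat) (a b t : R) (x s : seq R) :
    a <= t -> t < b ->
    diag_le_orbit n.+1 x ((a + b - t) :: s) ->
  diag_le_orbit n.+2 (t :: x) [:: a, b & s].
Proof.
move=> at_ tb [O [OO Ox]].
have [c [d [cd abt]]] := rotation_exists at_ tb.
pose e : 'rV[R]_n.+1 := delta_mx 0 0.
have ee : e *m e^T = 1%:M.
  by rewrite /e trmx_delta mul_delta_mx; apply/matrixP => i j; rewrite !ord1 !mxE.
(* [E] is the identity with [c] in its top left corner, which makes [G] a rotation in the plane of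
   the first two coordinates. *)
pose E : 'M[R]_n.+1 := 1%:M + (c - 1) *: (e^T *m e).
have Et : E^T = E by rewrite /E linearD linearZ /= trmx1 trmx_mul trmxK.
have eE : e *m E = c *: e.
  rewrite mulmxDr mulmx1 -scalemxAr mulmxA ee mul1mx -[X in X + _]scale1r -scalerDl.
  by congr (_ *: _); ring.
have Ee : E *m e^T = c *: e^T by rewrite -[LHS]trmxK trmx_mul trmxK Et eE linearZ.
pose G : 'M[R]_(1 + n.+1) := block_mx c%:M (- d *: e) (d *: e^T) E.
have GG : G^T *m G = 1%:M.
  rewrite tr_block_mx mulmx_block tr_scalar_mx !linearZ /= trmxK Et.
  have EE : E *m E = 1%:M + (c ^+ 2 - 1) *: (e^T *m e).
    rewrite {1}/E mulmxDl mul1mx -scalemxAl -mulmxA eE -scalemxAr scalerA.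
    by rewrite /E -addrA -scalerDl; congr (_ + _ *: _); ring.
  rewrite !(mul_scalar_mx, mul_mx_scalar) -!scalemxAl ee eE Ee EE.
  rewrite scale_scalar_mx !scalemx1 !scalerA addrCA -!scalerDl [RHS]scalar_mx_block.
  congr block_mx.
  - by rewrite scale_scalar_mx -raddfD -cd !expr2.
  - by rewrite (_ : _ + _ = 0) ?scale0r //; ring.
  - by rewrite (_ : _ + _ = 0) ?scale0r //; ring.
  - by rewrite (_ : - d * - d + _ = 0) ?scale0r ?addr0 // -cd; ring.
pose V := block_mx 1%:M 0 0 O : 'M[R]_(1 + n.+1).
pose U : 'M[R]_(1 + n.+1) := G *m V.
have UE : U = block_mx c%:M (- d *: row 0 O) (d *: e^T) (O + (c - 1) *: (e^T *m row 0 O)).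
  rewrite /U /G /V mulmx_block !mulmx1 !mulmx0 addr0 !add0r addr0.
  by rewrite -scalemxAl -rowE mulmxDl mul1mx -scalemxAl -mulmxA -rowE.
change (diag_le_orbit (1 + n.+1) (t :: x) [:: a, b & s]).
exists U; split.
  have VV : V^T *m V = 1%:M.
    rewrite tr_block_mx mulmx_block !trmx0 !mulmx0 !mul0mx trmx1 mulmx1 OO.
    by rewrite !addr0 add0r -scalar_mx_block.
  by rewrite trmx_mul -mulmxA (mulmxA G^T) GG mul1mx.
move=> i; rewrite (@big_split_ord _ _ _ 1 n.+1) big_ord1 UE /=.
have [j ->|j ->] := @split_ordP 1 n.+1 i.
  rewrite {j}(ord1 j) block_mxEul mxE eqxx mulr1n.
  rewrite (_ : nth _ _ _ = t) // -abt lerD2l.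
  rewrite big_ord_recl big1 => [|k _].
    by rewrite block_mxEdl !mxE eqxx addr0 mulr1.
  by rewrite block_mxEdl !mxE /= mulr0 expr0n mulr0.
apply: le_trans (Ox j).
rewrite !block_mxEur !big_ord_recl !block_mxEdr !mxE !big_ord1 !mxE /=.
rewrite addrA lerD //.
  (* The first two rows of [U] restrict here to [- d] and [c] times row 0 of [O]; their joint weight
     is the new eigenvalue. *)
  have -> : a + b - t = a * d ^+ 2 + b * c ^+ 2.
    have d2E : d ^+ 2 = 1 - c ^+ 2 by rewrite -cd; ring.
    by rewrite -abt d2E; ring.
  by rewrite le_eqVlt; apply/orP; left; apply/eqP; ring.
apply: ler_sum => k _; rewrite block_mxEdr !mxE !big_ord1 !mxE /=.
by rewrite mul0r mulr0 addr0.
Qed.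

Lemma diag_le_orbit_id (n : nat) (x y : seq R) :
  (forall i, (i < n)%N -> nth 0 y i <= nth 0 x i) -> diag_le_orbit n x y.
Proof.
move=> yx; exists 1%:M; split=> [|i]; first by rewrite trmx1 mulmx1.
rewrite (bigD1 i) //= big1 => [|j ji]; last by rewrite mxE (negPf ji) expr0n mulr0.
by rewrite mxE eqxx expr1n mulr1 addr0 yx.
Qed.

(** [b] is the first entry exceeding [t]; the condition on the head guarantees a predecessor [a]. *)
Lemma split_straddle (t : R) (y : seq R) :
    head t y <= t -> ~~ all (fun z => z <= t) y ->
  exists s1 a b s2,
    [/\ y = s1 ++ [:: a, b & s2], all (fun z => z <= t) s1, a <= t & t < b].
Proof.
case: y => // a y /=; elim: y a => [|b y IHy] a at_; rewrite at_ //= => Nall.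
have [bt|tb] := leP b t; last by exists [::], a, b, y.
have [|s1 [a' [b' [s2 [-> s1t a't tb']]]]] := IHy b bt.
  by move: Nall; rewrite bt.
by exists (a :: s1), a', b', s2; split; rewrite //= at_.
Qed.

Lemma sum_le_size (t : R) (s : seq R) :
  all (fun z => z <= t) s -> \sum_(z <- s) z <= (size s)%:R * t.
Proof.
elim: s => [|z s IHs] /=; first by rewrite big_nil mul0r.
by case/andP => zt /IHs; rewrite big_cons -natr1; lra.
Qed.

Lemma size_le_sum (t : R) (s : seq R) :
  all (fun z => t <= z) s -> (size s)%:R * t <= \sum_(z <- s) z.
Proof.
elim: s => [|z s IHs] /=; first by rewrite big_nil mul0r.
by case/andP => zt /IHs; rewrite big_cons -natr1; lra.
Qed.

(* Horn's induction: a rotation in the plane of the two consecutive eigenvalues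
   straddling the least [x] makes it a diagonal entry. *)
Lemma diag_le_orbit_supmaj (n : nat) (x y : seq R) :
    size x = n -> size y = n -> sorted <=%R x -> sorted <=%R y ->
    (forall k, (k <= n)%N ->
       \sum_(z <- take k y) z <= \sum_(z <- take k x) z) ->
  diag_le_orbit n x y.
Proof.
elim: n x y => [|n IHn] x y sx sy; first by move=> *; apply: diag_le_orbit_id.
case: x sx => // t x [sx] x_sorted y_sorted yx.
have tx : all (fun z => t <= z) x by apply: order_path_min x_sorted; apply: le_trans.
(* If no eigenvalue exceeds [t], the least entry of [x], the identity matrix already works. *)
have [yt|Nyt] := boolP (all (fun z => z <= t) y).
  apply: diag_le_orbit_id => i i_lt; apply: (@le_trans _ _ t).
    by apply: (all_nthP 0 yt); rewrite sy.
  case: i i_lt => //= i i_lt.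
  by apply: (all_nthP 0 tx); rewrite sx.
have y0t : head t y <= t.
  have := yx 1%N isT; rewrite /= take0 big_seq1.
  by case: (y) sy => //= z s _; rewrite take0 big_seq1.
have [s1 [a [b [s2 [yE s1t at_ tb]]]]] := split_straddle y0t Nyt.
have szs : n = (size s1 + size s2).+1.
  by move: sy; rewrite yE size_cat /= !addnS => -[].
have yperm : perm_eq [:: a, b & s1 ++ s2] y.
  by rewrite yE (perm_catCA [:: a; b] s1 s2) perm_refl.
apply: diag_le_orbit_perm yperm sy _.
rewrite szs; apply: diag_le_orbit_cons => //; rewrite -szs.
have y'perm : perm_eq (s1 ++ (a + b - t) :: s2) ((a + b - t) :: s1 ++ s2).
  by rewrite (perm_catCA s1 [:: _] s2) perm_refl.
apply: diag_le_orbit_perm y'perm _ _; first by rewrite /= size_cat szs.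
apply: IHn => //.
- by rewrite size_cat /= addnS szs.
- by move: x_sorted => /path_sorted.
(* The value [a + b - t] lies between [a] and [b], so it fits in their place without breaking the
   order. *)
- move: y_sorted; rewrite yE !(sorted_pairwise le_trans) !pairwise_cat /=.
  rewrite !allrel_consr => /and3P[/and3P[s1a s1b ->] -> /andP[/andP[ab as2] /andP[bs2 ->]]].
  rewrite !andbT; apply/andP; split.
    by apply: sub_all s1a => z za; lra.
  by apply: sub_all bs2 => z bz; lra.
(* A prefix inside [s1] has entries at most [t], while those of [x] are at least [t]. A longer
   prefix sums to that of [y] of length [k + 1] minus [t], and [t] is also the extra entry on the
   other side. *)
move=> k kn; have [ks1|s1k] := leqP k (size s1); first rewrite takel_cat //.
  apply: le_trans (sum_le_size (t := t) _) _.
    by apply/allP => z /mem_take; move: z; apply/allP.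
  apply: le_trans (size_le_sum (t := t) _); last first.
    by apply/allP => z /mem_take; move: z; apply/allP.
  by rewrite !size_takel ?sx // ltnW.
have := yx k.+1 kn; rewrite yE !take_cat !ltnNge (ltnW s1k) (leqW (ltnW s1k)) /=.
rewrite subSn ?(ltnW s1k) //; move: s1k; rewrite -subn_gt0.
case: (k - size s1)%N => // m _; rewrite /= !big_cat !big_cons /=; lra.
Qed.
End Horn.

(** * Symplectic congruences and the necessity of supermajorization *)

Section Symplectic.
Variable R : realType.

Definition dbl (n : nat) (d : 'rV[R]_n) : 'M[R]_(n + n) := diag_mx (row_mx d d).

Lemma Jmx_orthogonal (n : nat) : (Jmx R n)^T *m Jmx R n = 1%:M.
Proof.
rewrite /Jmx tr_block_mx mulmx_block !trmx0 [(- _)^T]linearN /= trmx1 !mulNmx !mulmxN.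
by rewrite !(mulmx1, mul0mx, mulmx0, oppr0, opprK, add0r, addr0) -scalar_mx_block.
Qed.

Lemma Jmx_dbl (n : nat) (d : 'rV[R]_n) : Jmx R n *m dbl d = dbl d *m Jmx R n.
Proof.
rewrite /Jmx /dbl diag_mx_row !mulmx_block !mulmx0 !mul0mx !mulNmx !mulmxN.
by rewrite !mulmx1 !mul1mx ?oppr0 ?add0r ?addr0.
Qed.

(** The matrix [S] of the overview: the half comes from [Delta_c], the four squares from the two
    copies of each row and column index. *)
Definition quad_mean (n : nat) (N : 'M[R]_(n + n)) : 'M[R]_n :=
  \matrix_(i, j) ((N (lshift n i) (lshift n j) ^+ 2
    + N (lshift n i) (rshift n j) ^+ 2 + N (rshift n i) (lshift n j) ^+ 2
    + N (rshift n i) (rshift n j) ^+ 2) / 2).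

Lemma frob_dbl (n : nat) (N : 'M[R]_(n + n)) (u v : 'rV[R]_n) :
  frob (dbl u *m N *m dbl v) =
  \sum_i \sum_j 2 * (u 0 i ^+ 2 * v 0 j ^+ 2) * quad_mean N i j.
Proof.
rewrite frobE big_split_ord /= -big_split; apply: eq_bigr => i _ /=.
rewrite !big_split_ord /= -!big_split; apply: eq_bigr => j _ /=.
rewrite /dbl !(mul_mx_diag, mul_diag_mx) !(row_mxEl, row_mxEr, mxE).
by field.
Qed.

(** The block bound for [N], with [I] and [K] doubled to both halves of the coordinates so that the
    two diagonal projections commute with [Jmx]. Trace, number of discarded rows and Frobenius norm
    all carry a factor 2, which cancels. *)
Lemma quad_mean_superstochastic (n : nat) (N : 'M[R]_(n + n)) (I K : {set 'I_n}) :
    symplectic N ->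
  (#|I| + #|K|)%:R - n%:R <= \sum_(i in I) \sum_(j in K) quad_mean N i j.
Proof.
move=> symN.
pose u : 'rV[R]_n := \row_i (i \in I)%:R.
pose v : 'rV[R]_n := \row_i (i \in K)%:R.
pose s := [seq lshift n i | i <- enum (~: I)] ++ [seq rshift n i | i <- enum (~: I)].
have TE : dbl u = diag_mx (\row_i (i \notin s)%:R).
  rewrite /dbl; congr diag_mx; apply/rowP => k.
  rewrite !mxE mem_cat; case: split_ordP => i ->; rewrite mxE.
    rewrite (mem_map (@lshift_inj _ _)) mem_enum inE.
    case: mapP => [[j _ /eqP]|_]; first by rewrite eq_lrshift.
    by rewrite orbF negbK.
  rewrite (mem_map (@rshift_inj _ _)) mem_enum inE.
  case: mapP => [[j _ /eqP]|_]; first by rewrite eq_rlshift.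
  by rewrite negbK.
have projv : orthoproj (dbl v).
  apply: orthoproj_diag => k; rewrite mxE.
  by case: split_ordP => i _; rewrite mxE; case: (_ \in _); [right | left | right | left].
have := @frob_block_ge _ _ (Jmx R n) N (dbl v) s (Jmx_orthogonal n) symN.
rewrite -TE => /(_ (Jmx_dbl u) projv (Jmx_dbl v)).
have -> : (size s)%:R = 2 * (n%:R - #|I|%:R) :> R.
  rewrite size_cat !size_map -cardE natrD.
  have /(congr1 (fun k => k%:R : R)) := cardsC I; rewrite natrD card_ord; lra.
have -> : \tr (dbl v) = 2 * #|K|%:R.
  rewrite /mxtrace big_split_ord /=.
  under eq_bigr do rewrite /dbl mxE eqxx row_mxEl mxE.
  under [X in _ + X]eq_bigr do rewrite /dbl mxE eqxx row_mxEr mxE.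
  rewrite -sumr_const [in RHS]big_mkcond; under [in RHS]eq_bigr do rewrite -mulrb.
  by rewrite mulr2n mulrDl !mul1r.
rewrite frob_dbl.
have -> : \sum_i \sum_j 2 * (u 0 i ^+ 2 * v 0 j ^+ 2) * quad_mean N i j =
    2 * \sum_(i in I) \sum_(j in K) quad_mean N i j.
  rewrite mulr_sumr [RHS]big_mkcond; apply: eq_bigr => i _.
  rewrite mxE; case: (i \in I); last first.
    by apply: big1 => j _; rewrite expr0n mul0r mulr0 mul0r.
  rewrite mulr_sumr [RHS]big_mkcond; apply: eq_bigr => j _.
  rewrite mxE; case: (j \in K); rewrite ?expr0n /=; ring.
rewrite natrD; lra.
Qed.

Lemma Delta_c_congr_dbl (n : nat) (N : 'M[R]_(n + n)) (d : 'rV[R]_n) j :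
  Delta_c (N^T *m dbl d *m N) 0 j = \sum_i d 0 i * quad_mean N i j.
Proof.
have diagE k : (N^T *m dbl d *m N) k k =
    \sum_i d 0 i * (N (lshift n i) k ^+ 2 + N (rshift n i) k ^+ 2).
  rewrite mxE big_split_ord /= -big_split; apply: eq_bigr => i _ /=.
  rewrite /dbl mul_mx_diag !(row_mxEl, row_mxEr, mxE); ring.
rewrite mxE !diagE -big_split mulr_suml; apply: eq_bigr => i _ /=.
by rewrite mxE; field.
Qed.

Lemma Delta_c_wsupmaj (n : nat) (A : 'M[R]_(n + n)) (d : 'rV[R]_n) :
  symp_eigs A d -> wsupmaj (Delta_c A) d.
Proof.
move=> [d_gt0 [d_mono [M [symM MAM]]]].
(* The symplectic identity for [M] exhibits this product as the inverse of [M]. *)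
pose N := (Jmx R n)^T *m M^T *m Jmx R n.
have NM : N *m M = 1%:M by rewrite /N -!mulmxA (mulmxA M^T) symM Jmx_orthogonal.
clearbody N; have MN := mulmx1C NM.
have symN : symplectic N.
  rewrite /symplectic -{1}symM !mulmxA -trmx_mul MN trmx1 mul1mx.
  by rewrite -mulmxA MN mulmx1.
have AE : A = N^T *m dbl d *m N.
  rewrite /dbl diag_mx_row -MAM !mulmxA -trmx_mul MN trmx1 mul1mx.
  by rewrite -mulmxA MN mulmx1.
apply: (wsupmaj_superstochastic (S := quad_mean N)) => //.
- by move=> i j; rewrite mxE divr_ge0 // !addr_ge0 // sqr_ge0.
- by move=> I K; apply: quad_mean_superstochastic.
- by move=> j; rewrite AE Delta_c_congr_dbl.
Qed.

(** * Construction of a matrix with prescribed means and symplectic eigenvalues *)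

Lemma squeeze_exists (u x : R) : 0 < u -> u <= x ->
  exists t : R, t != 0 /\ u * (t ^+ 2 + t ^- 2) / 2 = x.
Proof.
(* With [s = t ^+ 2] the equation reads [s + s^-1 = 2 * r]; its roots [r + q] and [r - q] are
   inverse to each other, and are real because [1 <= r]. *)
move=> u0 ux; pose r := x / u; pose q := Num.sqrt (r ^+ 2 - 1).
have r1 : 1 <= r by rewrite ler_pdivlMr // mul1r.
have q2 : q ^+ 2 = r ^+ 2 - 1 by rewrite sqr_sqrtr // subr_ge0 exprn_ege1.
have rq0 : 0 < r + q by rewrite ltr_wpDr ?sqrtr_ge0 //; lra.
exists (Num.sqrt (r + q)); split; first by rewrite gt_eqF // sqrtr_gt0.
rewrite sqr_sqrtr ?ltW //.
have -> : (r + q)^-1 = r - q.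
  apply: (mulfI (lt0r_neq0 rq0)); rewrite divff ?lt0r_neq0 //.
  have -> : (r + q) * (r - q) = r ^+ 2 - q ^+ 2 by ring.
  by rewrite q2; ring.
by rewrite /r; field; rewrite lt0r_neq0.
Qed.

Lemma posdef_congr_diag (m : nat) (N M : 'M[R]_m) (d : 'rV[R]_m) :
  (forall i, 0 < d 0 i) -> N *m M = 1%:M -> posdef (N^T *m diag_mx d *m N).
Proof.
move=> d0 NM; split; first by rewrite !trmx_mul trmxK tr_diag_mx mulmxA.
move=> v v0; pose w := v *m N^T.
have w0 : w != 0.
  apply: contraNneq v0 => w0; rewrite -[v]mulmx1 -trmx1 -(mulmx1C NM).
  by rewrite trmx_mul mulmxA -/w w0 mul0mx.
have -> : v *m (N^T *m diag_mx d *m N) *m v^T = w *m diag_mx d *m w^T.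
  by rewrite /w trmx_mul trmxK !mulmxA.
have -> : (w *m diag_mx d *m w^T) 0 0 = \sum_i d 0 i * w 0 i ^+ 2.
  by rewrite mxE; apply: eq_bigr => i _; rewrite mul_mx_diag !mxE; ring.
have term_ge0 i : 0 <= d 0 i * w 0 i ^+ 2 by rewrite mulr_ge0 ?sqr_ge0 // ltW.
rewrite lt_def sumr_ge0 // andbT; apply: contraNneq w0 => /psumr_eq0P w0.
apply/eqP/rowP => i; have /eqP := w0 (fun i _ => term_ge0 i) i isT.
by rewrite [in RHS]mxE mulf_eq0 gt_eqF //= sqrf_eq0 => /eqP.
Qed.

Lemma exists_posdef_Delta_c (n : nat) (x y : 'rV[R]_n) :
    (forall i, 0 < x 0 i) -> (forall i, 0 < y 0 i) -> wsupmaj x y ->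
  exists A : 'M[R]_(n + n),
    [/\ posdef A, Delta_c A = x & symp_eigs A (incr_vec y)].
Proof.
move=> x_gt0 y_gt0 yx.
have [p pE] := nth_incr_seq x; have [p' p'E] := nth_incr_seq y.
pose d := incr_vec y.
have d_gt0 i : 0 < d 0 i by rewrite mxE p'E.
have take_sum (z : 'rV[R]_n) k : (k <= n)%N ->
    \sum_(c <- take k (incr_seq z)) c = \sum_(j < k) nth 0 (incr_seq z) j.
  move=> kn; rewrite (big_nth 0) size_takel ?size_incr_seq // big_mkord.
  by apply: eq_bigr => j _; rewrite nth_take.
have [||||k kn|O [OO Ox]] :=
  @diag_le_orbit_supmaj R n (incr_seq x) (incr_seq y); rewrite ?size_incr_seq ?incr_seq_sorted //.
  rewrite !take_sum //; case: k kn => [|k] kn; first by rewrite !big_ord0.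
  exact: yx.
(* [V] conjugates [diag(d)] so that the diagonal lies below [x]. *)
pose V := col_perm p^-1 O.
have VV : V^T *m V = 1%:M.
  rewrite /V col_permE trmx_mul -mulmxA (mulmxA O^T) OO mul1mx.
  by rewrite tr_perm_mx -perm_mxM invgK mulgV perm_mx1.
have VV' := mulmx1C VV.
pose u i := \sum_(j < n) d 0 j * V j i ^+ 2.
have u_le i : u i <= x 0 i.
  have := Ox (p^-1 i)%g; rewrite pE permKV; apply: le_trans.
  by apply: ler_sum => j _; rewrite !mxE.
clearbody V.
(* If [u i] vanished, column [i] of the orthogonal [V] would be zero. Positivity is what allows
   squeezing [u i] up to [x 0 i]. *)
have u_gt0 i : 0 < u i.
  have term_ge0 j : 0 <= d 0 j * V j i ^+ 2 by rewrite mulr_ge0 ?sqr_ge0 // ltW.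
  rewrite lt_def sumr_ge0 // andbT; apply/eqP => /psumr_eq0P u0.
  have := congr1 (fun X : 'M_n => X i i) VV; rewrite /= !mxE eqxx big1.
    by move=> /esym/eqP; rewrite oner_eq0.
  move=> j _; have /eqP := u0 (fun j _ => term_ge0 j) j isT.
  by rewrite mulf_eq0 gt_eqF // sqrf_eq0 => /eqP ->; rewrite mulr0.
have [t tE] : exists t : 'I_n -> R, forall i, t i != 0 /\ u i * (t i ^+ 2 + t i ^- 2) / 2 = x 0 i.
  apply: (@fin_all_exists _ (fun=> R) (fun i ti => ti != 0 /\ u i * (ti ^+ 2 + ti ^- 2) / 2 = x 0 i)) => i.
  exact: squeeze_exists.
pose a := \row_i t i; pose b := \row_i (t i)^-1.
have ab : diag_mx a *m diag_mx b = 1%:M.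
  rewrite mulmx_diag -diag_const_mx; congr diag_mx; apply/rowP => i.
  by rewrite !mxE divff //; case: (tE i).
have ba := mulmx1C ab.
(* The rotation [V] acts alike on both halves, while [a] and [b] scale them inversely. The inverse
   [M] has the form of [X] and its inverse transpose on the diagonal, hence is symplectic. *)
pose N := block_mx (V *m diag_mx a) 0 0 (V *m diag_mx b).
pose M := block_mx (diag_mx b *m V^T) 0 0 (diag_mx a *m V^T).
have NM : N *m M = 1%:M.
  rewrite /N /M mulmx_block !mulmx0 !mul0mx !addr0 !add0r.
  rewrite !mulmxA -(mulmxA V) ab -(mulmxA V (diag_mx b)) ba mulmx1 VV'.
  by rewrite -scalar_mx_block.
have symM : symplectic M.
  rewrite /symplectic /M /Jmx tr_block_mx !mulmx_block !trmx0.
  rewrite !(mulmx0, mul0mx, addr0, add0r, mulmx1, mulmxN, mulNmx).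
  rewrite !trmx_mul !trmxK !tr_diag_mx -!mulmxA (mulmxA (diag_mx b)) ba.
  by rewrite (mulmxA (diag_mx a)) ab mul1mx VV'.
exists (N^T *m dbl d *m N); split.
- apply: posdef_congr_diag NM => i; rewrite mxE.
  by case: split_ordP => j _.
- apply/rowP => j; rewrite Delta_c_congr_dbl.
  have [tj0 <-] := tE j; rewrite /u mulr_suml mulr_suml.
  apply: eq_bigr => i _; rewrite [quad_mean _ _ _]mxE.
  rewrite /N block_mxEul block_mxEur block_mxEdl block_mxEdr.
  rewrite !mul_mx_diag !mxE; field.
  exact: tj0.
- split=> //; split=> [i j ij|].
    by rewrite !mxE; apply: incr_seq_mono; rewrite ij ltn_ord.
  exists M; split => //.
  rewrite -diag_mx_row -[diag_mx _]/(dbl d) !mulmxA -trmx_mul NM trmx1 mul1mx.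
  by rewrite -mulmxA NM mulmx1.
Qed.
End Symplectic.

Theorem theorem3 (R : realType) (n : nat) :
  (forall (A : 'M[R]_(n + n)) (d : 'rV[R]_n),
      posdef A -> symp_eigs A d -> wsupmaj (Delta_c A) d) /\
  (forall x y : 'rV[R]_n,
      (forall i, 0 < x 0 i) -> (forall i, 0 < y 0 i) -> wsupmaj x y ->
      exists A : 'M[R]_(n + n),
        [/\ posdef A, Delta_c A = x & symp_eigs A (incr_vec y)]).
Proof.
split=> [A d _|x y]; first exact: Delta_c_wsupmaj.
exact: exists_posdef_Delta_c.
Qed.
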